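(* Let $K$ be a field, $A$ a finite dimensional $K$-algebra, and $n$ a natural number. Let $X=X_1\oplus\cdots\oplus X_n$ and $Y=Y_1\oplus\cdots\oplus Y_n$ be finite dimensional multiplicity free tilting $A$-modules with all $X_i$ and $Y_i$ indecomposable. Then there exists a permutation $s$ of $\{1,\ldots,n\}$ such that for every $i=1,\ldots,n$, either $X_i\cong Y_{s(i)}$, or there exists a non-split short exact sequence of $A$-modules $$0\to U\to V\to W\to 0$$ with $\{U,W\}=\{X_i,Y_{s(i)}\}$.
   Context: All modules are finite dimensional left $A$-modules. A finite dimensional $A$-module $T$ is a tilting module if (α) its projective dimension is at most $1$, (β) $\operatorname{Ext}^1_A(T,T)=0$, and (γ) the number of isomorphism classes of indecomposable direct summands of $T$ equals the number of isomorphism classes of simple $A$-modules. A module is multiplicity free if its indecomposable direct summands (in a decomposition into indecomposables) are pairwise non-isomorphic. *)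

(* Defs.v *)
From HB Require Import structures.
From mathcomp Require Import all_boot all_order all_algebra all_fingroup.
From mathcomp Require Import falgebra.
Set Implicit Arguments. Unset Strict Implicit. Unset Printing Implicit Defensive.
Import GRing.Theory.
Local Open Scope ring_scope.

(* Finite dimensional left A-modules, A a finite dimensional K-algebra.
   A module of K-dimension d is given by a K-linear unital ring morphism
   A -> 'M[K]_d; elements of the module are column vectors 'cV[K]_d and
   a acts by left multiplication  v |-> mact a *m v. *)
Record fdmodule (K : fieldType) (A : falgType K) := FDModule {
  mdim : nat;
  mact : A -> 'M[K]_mdim;
  mact_add : forall a b, mact (a + b) = mact a + mact b;
  mact_scale : forall (k : K) a, mact (k *: a) = k *: mact a;
  mact_mul : forall a b, mact (a * b) = mact a *m mact b;
  mact_one : mact 1 = 1%:M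
}.

Section Modules.
Variables (K : fieldType) (A : falgType K).
Notation module := (fdmodule A).

Definition is_hom (M N : module) (f : 'M[K]_(mdim N, mdim M)) : Prop :=
  forall a : A, f *m mact M a = mact N a *m f.

Definition mod_iso (M N : module) : Prop :=
  exists (f : 'M[K]_(mdim N, mdim M)) (g : 'M[K]_(mdim M, mdim N)),
    [/\ is_hom f, is_hom g, g *m f = 1%:M & f *m g = 1%:M].

Definition injmx m n (f : 'M[K]_(n, m)) : Prop := \rank f = m.
Definition surjmx m n (f : 'M[K]_(n, m)) : Prop := \rank f = n.

Definition ses (U V W : module) (i : 'M[K]_(mdim V, mdim U))
  (p : 'M[K]_(mdim W, mdim V)) : Prop :=
  [/\ is_hom i, is_hom p, injmx i, surjmx p & p *m i = 0] /\
    mdim V = (mdim U + mdim W)%N.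

Definition ses_splits (U V : module) (i : 'M[K]_(mdim V, mdim U)) : Prop :=
  exists r : 'M[K]_(mdim U, mdim V), is_hom r /\ r *m i = 1%:M.

Definition nonsplit_ses_exists (U W : module) : Prop :=
  exists (V : module) (i : 'M[K]_(mdim V, mdim U)) (p : 'M[K]_(mdim W, mdim V)),
    ses i p /\ ~ ses_splits i.

Definition is_direct_sum (M : module) (n : nat) (X : 'I_n -> module) : Prop :=
  exists (inj : forall i, 'M[K]_(mdim M, mdim (X i)))
         (proj : forall i, 'M[K]_(mdim (X i), mdim M)),
    [/\ forall i, is_hom (inj i), forall i, is_hom (proj i),
        forall i, proj i *m inj i = 1%:M,
        forall i j, i != j -> proj i *m inj j = 0
      & \sum_i inj i *m proj i = 1%:M].

Definition pair_fam (M1 M2 : module) : 'I_2 -> module :=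
  fun i => if val i == 0%N then M1 else M2.

Definition is_zero_mod (M : module) : Prop := mdim M = 0%N.

Definition indecomposable (M : module) : Prop :=
  ~ is_zero_mod M /\
  forall M1 M2 : module, is_direct_sum M (pair_fam M1 M2) ->
    is_zero_mod M1 \/ is_zero_mod M2.

Definition direct_summand (Z T : module) : Prop :=
  exists Z' : module, is_direct_sum T (pair_fam Z Z').

Definition simple_mod (S : module) : Prop :=
  ~ is_zero_mod S /\
  forall (U : module) (f : 'M[K]_(mdim S, mdim U)), is_hom f -> injmx f ->
    is_zero_mod U \/ mdim U = mdim S.

Definition projective (P : module) : Prop :=
  forall (V W : module) (g : 'M[K]_(mdim W, mdim V)) (f : 'M[K]_(mdim W, mdim P)),
    is_hom g -> surjmx g -> is_hom f ->
    exists h : 'M[K]_(mdim V, mdim P), is_hom h /\ g *m h = f.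

Definition pdim_le1 (T : module) : Prop :=
  exists (P1 P0 : module) (i : 'M[K]_(mdim P0, mdim P1)) (p : 'M[K]_(mdim T, mdim P0)),
    [/\ projective P1, projective P0 & ses i p].

Definition ext1_vanishes (M N : module) : Prop :=
  forall (E : module) (i : 'M[K]_(mdim E, mdim N)) (p : 'M[K]_(mdim M, mdim E)),
    ses i p -> ses_splits i.

Definition num_simple_classes (k : nat) : Prop :=
  exists S : 'I_k -> module,
    [/\ forall i, simple_mod (S i),
        forall i j, i != j -> ~ mod_iso (S i) (S j)
      & forall S' : module, simple_mod S' -> exists i, mod_iso S' (S i)].

Definition num_indec_summand_classes (T : module) (k : nat) : Prop :=
  exists Z : 'I_k -> module,
    [/\ forall i, indecomposable (Z i) /\ direct_summand (Z i) T,
        forall i j, i != j -> ~ mod_iso (Z i) (Z j)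
      & forall Z' : module, indecomposable Z' -> direct_summand Z' T ->
          exists i, mod_iso Z' (Z i)].

Definition tilting (T : module) : Prop :=
  [/\ pdim_le1 T, ext1_vanishes T T &
      exists k, num_indec_summand_classes T k /\ num_simple_classes k].

End Modules.

(* Main.v *)
(** Join [X_i] and [Y_j] when they are isomorphic or some [Ext^1] between them
    is nonzero; Hall's marriage theorem applies: for a set [I] of indices with
    set of neighbours [N(I)], the family of all [X_i], [i] in [I], and [Y_j],
    [j] not in [N(I)], consists of pairwise non-isomorphic indecomposables of
    projective dimension at most 1 without extensions between them, and such a
    family has at most as many members as there are simple modules.

    This last bound is proved directly. If there were more modules [M_x] than
    simples, there would be rational [c_x], not all zero, with
    [sum_x c_x chi(M_x, N) = 0] for all [N], where
    [chi(M, N) = dim Hom(M, N) - dim Ext^1(M, N)] is additive in [N]. Testing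
    this on modules [N] with [Ext^1(M_x, N) = 0] for all [x] shows that the
    [M_x] with [c_x > 0] and those with [c_x < 0] generate each other, which
    Nakayama's lemma forbids. *)
Require Import Defs.
From HB Require Import structures.
From mathcomp Require Import all_boot all_order all_algebra all_fingroup.
From mathcomp Require Import falgebra boolp.

Set Implicit Arguments.
Unset Strict Implicit.
Unset Printing Implicit Defensive.
Import Order.TTheory GRing.Theory Num.Theory.
(* [all_fingroup] also exports a [mact]. *)
Import Defs.

(** * Hall's marriage theorem *)

Section Hall.
Variables S T : finType.
Implicit Types (N : S -> {set T}) (I : {set S}).

Definition neighbours N I := \bigcup_(x in I) N x.

Definition remove N x y z := if z == x then N z :\ y else N z.

Lemma neighbours_remove N x y I :
  x \notin I -> neighbours (remove N x y) I = neighbours N I.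
Proof.
move=> xI; apply: eq_bigr => z zI; rewrite /remove.
by case: eqP zI => // ->; rewrite (negPf xI).
Qed.

Lemma neighbours_removeU1 N x y I :
  x \notin I ->
  neighbours (remove N x y) (x |: I) = (N x :\ y) :|: neighbours N I.
Proof.
by move=> xI; rewrite {1}/neighbours big_setU1 //= {1}/remove eqxx -/(neighbours _ _)
  neighbours_remove.
Qed.

(** A violating set must contain [x], since otherwise its neighbours are unchanged; taking [x] out
    of it turns the strict violation into a weak inequality. *)
Lemma remove_violation N x y :
  (forall I : {set S}, #|I| <= #|neighbours N I|) ->
  ~ (forall I : {set S}, #|I| <= #|neighbours (remove N x y) I|) ->
  exists2 I : {set S}, x \notin I & #|(N x :\ y) :|: neighbours N I| <= #|I|.
Proof.
move=> hallN /existsNP[I /negP]; rewrite -ltnNge => ltI.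
have xI : x \in I.
  by apply: contraLR ltI => xI; rewrite -leqNgt neighbours_remove.
exists (I :\ x); first by rewrite !inE eqxx.
have xI' : x \notin I :\ x by rewrite !inE eqxx.
by move: ltI; rewrite -{1 2}(setD1K xI) neighbours_removeU1 // cardsU1 xI' ltnS.
Qed.

(* Rado's argument: from a set with two elements one of them can be removed
   without destroying Hall's condition, by submodularity of cardinality. *)
Lemma hall_marriage N :
  (forall I : {set S}, #|I| <= #|neighbours N I|) ->
  exists f : S -> T, injective f /\ forall x, f x \in N x.
Proof.
have [m] := ubnP (\sum_x #|N x|); elim: m N => // m IH N le_m hallN.
have N_gt0 x : 0 < #|N x|.
  by move: (hallN [set x]); rewrite cards1 /neighbours big_set1.
have [/existsP[x lt1]|/existsPn le1] := boolP [exists x, 1 < #|N x|]; last first.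
  (* All [N x] are singletons here, and Hall's condition on pairs makes the resulting map
     injective. *)
  have N1 x : exists y, N x = [set y].
    by apply/cards1P; rewrite eqn_leq N_gt0 andbT leqNgt le1.
  have [f fE] := choice N1; exists f; split=> [x y fxy|x]; last by rewrite fE set11.
  apply/eqP; move: (hallN [set x; y]).
  by rewrite /neighbours bigcup_setU !big_set1 !fE fxy setUid cards1 cards2; case: eqP.
have try y : y \in N x ->
    (forall I : {set S}, #|I| <= #|neighbours (remove N x y) I|) ->
    exists f : S -> T, injective f /\ forall x, f x \in N x.
  move=> yN hallR; have [|f [injf fR]] := IH (remove N x y) _ hallR.
    rewrite ltnS in le_m; apply: leq_trans le_m.
    rewrite (bigD1 x) //= [X in _ < X](bigD1 x) //= /remove eqxx (cardsD1 y (N x)) yN.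
    rewrite add1n addSn ltnS leq_add2l; apply: leq_sum => z /negPf-> //.
  exists f; split=> // z; move: (fR z); rewrite /remove.
  by case: eqP => // _ /setD1P[].
have /card_gt1P[y1 [y2 [y1N y2N y12]]] := lt1.
have [/(try _ y1N)//|bad1] :=
  pselect (forall I : {set S}, #|I| <= #|neighbours (remove N x y1) I|).
have [/(try _ y2N)//|bad2] :=
  pselect (forall I : {set S}, #|I| <= #|neighbours (remove N x y2) I|).
have [I1 xI1 le_1] := remove_violation hallN bad1.
have [I2 xI2 le_2] := remove_violation hallN bad2.
have := hallN (I1 :&: I2); have := hallN (x |: (I1 :|: I2)).
rewrite cardsU1 !inE negb_or xI1 xI2 add1n => hU hI.
(* Since [y1] and [y2] differ, the union of the two bounded sets contains all neighbours of
   [x |: (I1 :|: I2)]; their intersection contains those of [I1 :&: I2]. The extra element [x] makes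
   the sum of the two bounds too small by one. *)
have := leq_add le_1 le_2; rewrite -[X in _ <= X]cardsUI -cardsUI leqNgt => /negP[].
rewrite -addSn leq_add //.
  apply: leq_trans hU (subset_leq_card _).
  apply/bigcupsP => z; rewrite !inE => /or3P[/eqP->|zI|zI].
  - apply/subsetP => y yN; rewrite !inE yN.
    by have [->|_] := eqVneq y y1; rewrite ?y12 ?orbT.
  - apply/subsetP => y yN; rewrite !inE; apply/orP; left; apply/orP; right.
    by apply/bigcupP; exists z.
  - apply/subsetP => y yN; rewrite !inE; apply/orP; right; apply/orP; right.
    by apply/bigcupP; exists z.
apply: leq_trans hI (subset_leq_card _).
apply/bigcupsP => z; rewrite !inE => /andP[z1 z2]; apply/subsetP => y yN; rewrite !inE.
by apply/andP; split; apply/orP; right; apply/bigcupP; exists z.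
Qed.

End Hall.
Local Open Scope ring_scope.

(** * Homomorphisms, kernels, cokernels, images, direct sums and short exact sequences *)

Section Homomorphisms.
Variables (K : fieldType) (A : falgType K).
Implicit Types (L M N P U V W X : fdmodule A).

Lemma hom_mul M N P (g : 'M_(mdim P, mdim N)) (f : 'M_(mdim N, mdim M)) :
  is_hom g -> is_hom f -> is_hom (g *m f).
Proof. by move=> hg hf a; rewrite -mulmxA hf mulmxA hg mulmxA. Qed.

Lemma hom_add M N (f g : 'M_(mdim N, mdim M)) :
  is_hom f -> is_hom g -> is_hom (f + g).
Proof. by move=> hf hg a; rewrite mulmxDl hf hg mulmxDr. Qed.

Lemma hom_opp M N (f : 'M_(mdim N, mdim M)) : is_hom f -> is_hom (- f).
Proof. by move=> hf a; rewrite mulNmx hf mulmxN. Qed.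

Lemma hom_sub M N (f g : 'M_(mdim N, mdim M)) :
  is_hom f -> is_hom g -> is_hom (f - g).
Proof. by move=> hf hg; apply: hom_add => //; apply: hom_opp. Qed.

Lemma hom0 M N : @is_hom _ _ M N 0.
Proof. by move=> a; rewrite mul0mx mulmx0. Qed.

Lemma hom1 M : @is_hom _ _ M M 1%:M.
Proof. by move=> a; rewrite mul1mx mulmx1. Qed.

Lemma hom_sum M N I (r : seq I) (F : I -> 'M_(mdim N, mdim M)) :
  (forall i, is_hom (F i)) -> is_hom (\sum_(i <- r) F i).
Proof. by move=> hF; elim/big_rec: _ => [|i f _ hf]; [apply: hom0 | apply: hom_add]. Qed.

Lemma injmx_full m n (f : 'M[K]_(n, m)) : injmx f <-> row_full f.
Proof. by split=> [/eqP|/eqP]. Qed.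

Lemma surjmx_free m n (f : 'M[K]_(n, m)) : surjmx f <-> row_free f.
Proof. by split=> [/eqP|/eqP]. Qed.

Lemma injmx_cancel m n p (f : 'M[K]_(n, m)) (g h : 'M_(m, p)) :
  injmx f -> f *m g = f *m h -> g = h.
Proof. by move=> /injmx_full /row_full_inj; apply. Qed.

Lemma surjmx_cancel m n p (f : 'M[K]_(n, m)) (g h : 'M_(p, n)) :
  surjmx f -> g *m f = h *m f -> g = h.
Proof. by move=> /surjmx_free /row_free_inj; apply. Qed.

Lemma surjmx_rinv m n (f : 'M[K]_(n, m)) : surjmx f -> exists g, f *m g = 1%:M.
Proof. by move=> /surjmx_free /row_freeP. Qed.

Lemma injmx_linv m n (f : 'M[K]_(n, m)) : injmx f -> exists g, g *m f = 1%:M.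
Proof. by move=> /injmx_full /row_fullP. Qed.

Lemma linv_injmx m n (f : 'M[K]_(n, m)) g : g *m f = 1%:M -> injmx f.
Proof. by move=> gf; apply/injmx_full/row_fullP; exists g. Qed.

Lemma rinv_surjmx m n (f : 'M[K]_(n, m)) g : f *m g = 1%:M -> surjmx f.
Proof. by move=> fg; apply/surjmx_free/row_freeP; exists g. Qed.

Lemma injmxI m n (f : 'M[K]_(n, m)) :
  (forall r (x : 'M_(m, r)), f *m x = 0 -> x = 0) -> injmx f.
Proof.
move=> inj0; apply/injmx_full; rewrite /row_full -mxrank_tr -/(row_free _) -kermx_eq0.
apply/eqP/trmx_inj; rewrite trmx0; apply: inj0.
by apply: trmx_inj; rewrite trmx_mul trmxK mulmx_ker trmx0.
Qed.

Lemma surjmx_mul m n p (f : 'M[K]_(n, m)) (g : 'M_(p, n)) :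
  surjmx f -> surjmx g -> surjmx (g *m f).
Proof.
move=> /surjmx_rinv[f' ff'] /surjmx_rinv[g' gg'].
by apply: (@rinv_surjmx _ _ _ (f' *m g')); rewrite mulmxA -(mulmxA g) ff' mulmx1.
Qed.

Lemma hom_injmx_cancel M N P (i : 'M_(mdim P, mdim N)) (f : 'M_(mdim N, mdim M)) :
  is_hom i -> injmx i -> is_hom (i *m f) -> is_hom f.
Proof.
by move=> hi injI hif a; apply: (injmx_cancel injI); rewrite mulmxA hif !mulmxA hi.
Qed.

Lemma hom_surjmx_cancel M N P (f : 'M_(mdim P, mdim N)) (p : 'M_(mdim N, mdim M)) :
  is_hom p -> surjmx p -> is_hom (f *m p) -> is_hom f.
Proof.
by move=> hp surjP hfp a; apply: (surjmx_cancel surjP); rewrite -!mulmxA -hp mulmxA hfp.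
Qed.

(** The action is transported along a left inverse of [j]. As [mdim U] and [r] have only a
    propositional equality once [U] is hidden, [j] and [j'] are related by factorizations in both
    directions. *)
Lemma submodule_exists N r (j : 'M[K]_(mdim N, r)) :
  injmx j -> (forall a, exists b, mact N a *m j = j *m b) ->
  exists (U : fdmodule A) (j' : 'M_(mdim N, mdim U)) u,
    [/\ is_hom j', injmx j', mdim U = r, j = j' *m u & exists v, j' = j *m v].
Proof.
move=> injJ stab; have [l lj] := injmx_linv injJ.
pose act a := l *m mact N a *m j.
have actE a : j *m act a = mact N a *m j.
  by have [b ab] := stab a; rewrite /act -mulmxA ab (mulmxA l) lj mul1mx.
have actD a b : act (a + b) = act a + act b by rewrite /act mact_add mulmxDr mulmxDl.
have actZ k a : act (k *: a) = k *: act a.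
  by rewrite /act mact_scale -scalemxAr -scalemxAl.
have actM a b : act (a * b) = act a *m act b.
  by apply: (injmx_cancel injJ); rewrite actE mact_mul -mulmxA -actE mulmxA -actE mulmxA.
have act1 : act 1 = 1%:M by rewrite /act mact_one mulmx1.
exists (FDModule actD actZ actM act1), j, 1%:M; split=> //; rewrite ?mulmx1 //.
by exists 1%:M; rewrite mulmx1.
Qed.

Lemma quotient_exists N r (q : 'M[K]_(r, mdim N)) :
  surjmx q -> (forall a, exists b, q *m mact N a = b *m q) ->
  exists (U : fdmodule A) (q' : 'M_(mdim U, mdim N)) u,
    [/\ is_hom q', surjmx q', mdim U = r, q = u *m q' & exists v, q' = v *m q].
Proof.
move=> surjQ stab; have [l ql] := surjmx_rinv surjQ.
pose act a := q *m mact N a *m l.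
have actE a : act a *m q = q *m mact N a.
  by have [b ab] := stab a; rewrite /act ab -(mulmxA b q) ql mulmx1.
have actD a b : act (a + b) = act a + act b by rewrite /act mact_add mulmxDr mulmxDl.
have actZ k a : act (k *: a) = k *: act a.
  by rewrite /act mact_scale -scalemxAr -scalemxAl.
have actM a b : act (a * b) = act a *m act b.
  by apply: (surjmx_cancel surjQ); rewrite actE mact_mul mulmxA -actE -mulmxA -actE mulmxA.
have act1 : act 1 = 1%:M by rewrite /act mact_one mulmx1.
exists (FDModule actD actZ actM act1), q, 1%:M; split=> //; rewrite ?mul1mx //.
by exists 1%:M; rewrite mul1mx.
Qed.

Lemma kernel_exists M N (f : 'M_(mdim N, mdim M)) : is_hom f ->
  exists L (j : 'M_(mdim M, mdim L)),
    [/\ is_hom j, injmx j, f *m j = 0, mdim L = (mdim M - \rank f)%N &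
        forall r (g : 'M_(mdim M, r)), f *m g = 0 -> exists h, g = j *m h].
Proof.
(* [kermx] is a space of rows, while elements of modules are columns; hence the transposes. *)
move=> hf; pose j := (row_base (kermx f^T))^T.
have fj : f *m j = 0.
  apply: trmx_inj; rewrite trmx_mul trmxK trmx0; apply/sub_kermxP.
  by rewrite eq_row_base.
have fac r (g : 'M_(mdim M, r)) : f *m g = 0 -> exists h, g = j *m h.
  move=> fg; have /submxP[h hE] : (g^T <= row_base (kermx f^T))%MS.
    by rewrite eq_row_base; apply/sub_kermxP; rewrite -trmx_mul fg trmx0.
  by exists h^T; rewrite /j -trmx_mul -hE trmxK.
have injJ : injmx j.
  by apply/injmx_full; rewrite /row_full mxrank_tr; apply: row_base_free.
have [|L [j' [u [hj' injJ' dL jE [v j'E]]]]] := submodule_exists injJ.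
  by move=> a; apply: fac; rewrite mulmxA hf -mulmxA fj mulmx0.
exists L, j'; split=> //; first by rewrite j'E mulmxA fj mul0mx.
  by rewrite dL mxrank_ker mxrank_tr.
by move=> r g /fac[h ->]; exists (u *m h); rewrite mulmxA -jE.
Qed.

Lemma cokernel_exists M N (f : 'M_(mdim N, mdim M)) : is_hom f ->
  exists C (q : 'M_(mdim C, mdim N)),
    [/\ is_hom q, surjmx q, q *m f = 0, mdim C = (mdim N - \rank f)%N &
        forall r (g : 'M_(r, mdim N)), g *m f = 0 -> exists h, g = h *m q].
Proof.
move=> hf; pose q := row_base (kermx f).
have qf : q *m f = 0 by apply/sub_kermxP; rewrite eq_row_base.
have fac r (g : 'M_(r, mdim N)) : g *m f = 0 -> exists h, g = h *m q.
  by move=> gf; apply/submxP; rewrite eq_row_base; apply/sub_kermxP.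
have surjQ : surjmx q by apply/surjmx_free/row_base_free.
have [|C [q' [u [hq' surjQ' dC qE [v q'E]]]]] := quotient_exists surjQ.
  by move=> a; apply: fac; rewrite -mulmxA -hf mulmxA qf mul0mx.
exists C, q'; split=> //; first by rewrite q'E -mulmxA qf mulmx0.
  by rewrite dC mxrank_ker.
by move=> r g /fac[h ->]; exists (h *m u); rewrite -mulmxA -qE.
Qed.

Lemma image_exists M N (f : 'M_(mdim N, mdim M)) : is_hom f ->
  exists I (j : 'M_(mdim N, mdim I)) (q : 'M_(mdim I, mdim M)),
    [/\ is_hom j, is_hom q, injmx j, surjmx q & f = j *m q].
Proof.
move=> hf; have injJ : injmx (col_base f) by apply/injmx_full/col_base_full.
have surjQ : surjmx (row_base f) by apply/surjmx_free/row_base_free.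
move: (col_base f) (row_base f) (mulmx_base f) injJ surjQ => j q jq injJ surjQ.
have [q' qq'] := surjmx_rinv surjQ.
have [a|I [j' [u [hj injJ' dI jE _]]]] := submodule_exists injJ.
  exists (q *m mact M a *m q').
  by rewrite -[LHS]mulmx1 -qq' !mulmxA -(mulmxA (mact N a) j) jq hf.
have fE : f = j' *m (u *m q) by rewrite mulmxA -jE.
exists I, j', (u *m q); split=> //; first by apply: (hom_injmx_cancel hj injJ'); rewrite -fE.
apply/eqP; rewrite eqn_leq rank_leq_row {1}dI /=.
by move: (mxrankM_maxr j' (u *m q)); rewrite -fE.
Qed.

(** Kept transparent, so that its dimension reduces to [0]. *)
Definition zero_module : fdmodule A.
Proof. by apply: (@FDModule _ _ 0 (fun=> 0)) => *; apply/matrixP => -[]. Defined.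

Section DirectSum.
Variables M N : fdmodule A.

Let act a : 'M_(mdim M + mdim N) := block_mx (mact M a) 0 0 (mact N a).

Fact dsum_add a b : act (a + b) = act a + act b.
Proof. by rewrite /act !mact_add add_block_mx !addr0. Qed.

Fact dsum_scale k a : act (k *: a) = k *: act a.
Proof. by rewrite /act !mact_scale scale_block_mx !scaler0. Qed.

Fact dsum_mul a b : act (a * b) = act a *m act b.
Proof.
by rewrite /act !mact_mul mulmx_block !mul0mx !mulmx0 !addr0 !add0r.
Qed.

Fact dsum_one : act 1 = 1%:M.
Proof. by rewrite /act !mact_one -scalar_mx_block. Qed.

Definition dsum : fdmodule A := FDModule dsum_add dsum_scale dsum_mul dsum_one.

Definition inl_mx : 'M[K]_(mdim dsum, mdim M) := col_mx 1%:M 0.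
Definition inr_mx : 'M[K]_(mdim dsum, mdim N) := col_mx 0 1%:M.
Definition copair X (f : 'M[K]_(mdim X, mdim M)) (g : 'M_(mdim X, mdim N)) :
  'M_(mdim X, mdim dsum) := row_mx f g.

Lemma hom_inl : is_hom inl_mx.
Proof.
by move=> a; rewrite mul_col_mx mul_block_col !mulmx0 !mul0mx mul1mx mulmx1 !addr0.
Qed.

Lemma hom_inr : is_hom inr_mx.
Proof.
by move=> a; rewrite mul_col_mx mul_block_col !mulmx0 !mul0mx mul1mx mulmx1 !add0r.
Qed.

Lemma hom_copair X (f : 'M[K]_(mdim X, mdim M)) (g : 'M_(mdim X, mdim N)) :
  is_hom f -> is_hom g -> is_hom (copair f g).
Proof.
by move=> hf hg a; rewrite mul_row_block mul_mx_row !mulmx0 addr0 add0r hf hg.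
Qed.

Lemma copair_inl X (f : 'M[K]_(mdim X, mdim M)) (g : 'M_(mdim X, mdim N)) :
  copair f g *m inl_mx = f.
Proof. by rewrite mul_row_col mulmx1 mulmx0 addr0. Qed.

Lemma copair_inr X (f : 'M[K]_(mdim X, mdim M)) (g : 'M_(mdim X, mdim N)) :
  copair f g *m inr_mx = g.
Proof. by rewrite mul_row_col mulmx1 mulmx0 add0r. Qed.

Lemma dsum_hom_ext p (f g : 'M[K]_(p, mdim dsum)) :
  f *m inl_mx = g *m inl_mx -> f *m inr_mx = g *m inr_mx -> f = g.
Proof.
rewrite -(hsubmxK (f : 'M_(_, _ + _))) -(hsubmxK (g : 'M_(_, _ + _))).
by rewrite !mul_row_col !mulmx1 !mulmx0 !addr0 !add0r => -> ->.
Qed.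

Lemma dsum_col r (v : 'M[K]_(mdim dsum, r)) : exists x y, v = inl_mx *m x + inr_mx *m y.
Proof.
exists (usubmx (v : 'M_(_ + _, _))), (dsubmx (v : 'M_(_ + _, _))).
by rewrite !mul_col_mx !mul1mx !mul0mx add_col_mx addr0 add0r vsubmxK.
Qed.

End DirectSum.

(** Exactness in the middle: [p *m i = 0] puts the image of [i] inside the kernel of [p], and the
    dimension count in [ses] makes them equal. *)
Lemma ses_factor U V W (i : 'M_(mdim V, mdim U)) (p : 'M_(mdim W, mdim V)) r
    (g : 'M_(mdim V, r)) :
  ses i p -> p *m g = 0 -> exists h, g = i *m h.
Proof.
move=> [[hi hp injI surjP pi0] dV] pg.
have /submxP[h gE] : (g^T <= i^T)%MS.
  have ipk : (i^T <= kermx p^T)%MS by apply/sub_kermxP; rewrite -trmx_mul pi0 trmx0.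
  have : (g^T <= kermx p^T)%MS by apply/sub_kermxP; rewrite -trmx_mul pg trmx0.
  move=> /submx_trans; apply.
  by rewrite -(mxrank_leqif_sup ipk) mxrank_ker !mxrank_tr injI surjP dV addnK.
by exists h^T; apply: trmx_inj; rewrite trmx_mul trmxK.
Qed.

(** For a linear section [s] of [p], the map [s *m p - 1] lands in the image of [i], which [g]
    kills; so [g = g *m s *m p]. *)
Lemma ses_cofactor U V W (i : 'M_(mdim V, mdim U)) (p : 'M_(mdim W, mdim V)) r
    (g : 'M_(r, mdim V)) :
  ses i p -> g *m i = 0 -> exists h, g = h *m p.
Proof.
move=> sip gi; have [s ps] : exists s, p *m s = 1%:M.
  by case: sip => -[_ _ _ surjP _] _; apply: surjmx_rinv.
have [|h hE] := @ses_factor _ _ _ _ _ _ (s *m p - 1%:M) sip.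
  by rewrite mulmxBr mulmxA ps mul1mx mulmx1 subrr.
exists (g *m s); apply/eqP; rewrite -subr_eq0 -opprB oppr_eq0 -mulmxA -{2}[g]mulmx1.
by rewrite -mulmxBr hE mulmxA gi mul0mx.
Qed.

Lemma kernel_ses V W (p : 'M_(mdim W, mdim V)) : is_hom p -> surjmx p ->
  exists U (i : 'M_(mdim V, mdim U)), ses i p.
Proof.
move=> hp surjP; have [U [i [hi injI pi0 dU _]]] := kernel_exists hp.
by exists U, i; split=> //; rewrite dU -{2}surjP subnK // rank_leq_col.
Qed.

Lemma cokernel_ses U V (i : 'M_(mdim V, mdim U)) : is_hom i -> injmx i ->
  exists W (p : 'M_(mdim W, mdim V)), ses i p.
Proof.
move=> hi injI; have [W [p [hp surjP pi0 dW _]]] := cokernel_exists hi.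
by exists W, p; split=> //; rewrite dW -{1}injI subnKC // rank_leq_row.
Qed.

End Homomorphisms.

(** * Dimensions of Hom spaces *)

Section Dimensions.
Variables (K : fieldType) (A : falgType K).
Implicit Types (L M N P U V W X : fdmodule A).

(** Commuting with a basis of [A] suffices, so the homomorphisms form a finite intersection of
    kernels, a subspace with a dimension. *)
Definition homs M N : {vspace 'M[K]_(mdim N, mdim M)} :=
  (\bigcap_(i < \dim {:A}) lker (linfun
     (mulmxr (mact M (vbasis {:A})`_i) \- mulmx (mact N (vbasis {:A})`_i))))%VS.

Lemma mem_homs M N (f : 'M_(mdim N, mdim M)) : f \in homs M N <-> is_hom f.
Proof.
have memE i : (f \in lker (linfun
     (mulmxr (mact M (vbasis {:A})`_i) \- mulmx (mact N (vbasis {:A})`_i)))) =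
    (f *m mact M (vbasis {:A})`_i == mact N (vbasis {:A})`_i *m f).
  by rewrite memv_ker lfunE /= subr_eq0.
split=> [fH a|hf]; last first.
  rewrite memvE; apply/subv_bigcapP => i _.
  by rewrite -memvE memE hf.
have act_sum Q (F : 'I_(\dim {:A}) -> A) : mact Q (\sum_i F i) = \sum_i mact Q (F i).
  apply: (big_morph (mact Q)) => [x y|]; first exact: mact_add.
  by rewrite -[0 in LHS](scale0r 0) mact_scale scale0r.
rewrite (coord_vbasis (memvf a)) !act_sum mulmx_sumr mulmx_suml; apply: eq_bigr => i _.
rewrite !mact_scale -scalemxAr -scalemxAl; congr (_ *: _); apply/eqP.
by rewrite -memE memvE; move: fH; rewrite memvE => /subv_bigcapP; apply.
Qed.

Lemma homs_eq0 M N (f : 'M_(mdim N, mdim M)) :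
  \dim (homs M N) = 0%N -> is_hom f -> f = 0.
Proof. by move=> /eqP; rewrite dimv_eq0 => /eqP H0 /mem_homs; rewrite H0 memv0 => /eqP. Qed.

Lemma homs_dim0 M N :
  (forall f : 'M_(mdim N, mdim M), is_hom f -> f = 0) -> \dim (homs M N) = 0%N.
Proof.
move=> H; apply/eqP; rewrite dimv_eq0 -subv0; apply/subvP => f /mem_homs /H ->.
exact: mem0v.
Qed.

(** Stated relative to subspaces because composition is linear on all matrices, while exactness is
    only claimed on homomorphisms. *)
Lemma dimv_exact (V1 V2 V3 : vectType K) (f : {linear V1 -> V2}) (g : {linear V2 -> V3})
    (U1 : {vspace V1}) (U2 : {vspace V2}) (U3 : {vspace V3}) :
  {in U1, forall x, f x \in U2} -> {in U1, forall x, f x = 0 -> x = 0} ->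
  {in U1, forall x, g (f x) = 0} ->
  {in U2, forall y, g y = 0 -> exists2 x, x \in U1 & f x = y} ->
  {in U2, forall y, g y \in U3} ->
  {in U3, forall z, exists2 y, y \in U2 & g y = z} ->
  \dim U2 = (\dim U1 + \dim U3)%N.
Proof.
move=> fU injf gf ker_g gU surjg; rewrite -(limg_ker_dim (linfun g) U2); congr addn.
  suff <- : (linfun f @: U1)%VS = (U2 :&: lker (linfun g))%VS.
    apply: limg_dim_eq; apply/eqP; rewrite -subv0; apply/subvP => x.
    rewrite memv_cap memv_ker lfunE memv0 => /andP[xU /eqP fx].
    by rewrite (injf x).
  apply/vspaceP => y; rewrite memv_cap memv_ker lfunE; apply/memv_imgP/andP.
    by move=> [x xU ->]; rewrite lfunE fU // gf //.
  by move=> [yU /eqP gy]; have [x xU <-] := ker_g y yU gy; exists x; rewrite ?lfunE.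
congr (\dim _); apply/vspaceP => z; apply/memv_imgP/idP.
  by move=> [y yU ->]; rewrite lfunE gU.
by move=> zU; have [y yU <-] := surjg z zU; exists y; rewrite ?lfunE.
Qed.

Lemma dim_homs_projective P U V W (i : 'M_(mdim V, mdim U)) (p : 'M_(mdim W, mdim V)) :
  projective P -> ses i p ->
  \dim (homs P V) = (\dim (homs P U) + \dim (homs P W))%N.
Proof.
move=> projP sip; have [[hi hp injI surjP pi0] _] := sip.
apply: (@dimv_exact _ _ _ (mulmx i) (mulmx p)) => /= [f|f _ fi0|f _|f|f|f].
- by move=> /mem_homs hf; apply/mem_homs/hom_mul.
- by apply: (injmx_cancel injI); rewrite fi0 mulmx0.
- by rewrite mulmxA pi0 mul0mx.
- move=> /mem_homs hf /(ses_factor sip)[h fE]; exists h => //.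
  by apply/mem_homs/(hom_injmx_cancel hi injI); rewrite -fE.
- by move=> /mem_homs hf; apply/mem_homs/hom_mul.
- move=> /mem_homs hf; have [h [hh <-]] := projP _ _ _ _ hp surjP hf.
  by exists h => //; apply/mem_homs.
Qed.

End Dimensions.

(** * Projective resolutions of length one, [Ext^1] and the Euler characteristic *)

Section Resolutions.
Variables (K : fieldType) (A : falgType K).
Implicit Types (L M N P U V W X : fdmodule A).

(** The witnesses of [pdim_le1] as data, on which [res_ext0] and [euler] can depend. *)
Record resolution M := Resolution {
  res1 : fdmodule A;
  res0 : fdmodule A;
  res_in : 'M[K]_(mdim res0, mdim res1);
  res_aug : 'M[K]_(mdim M, mdim res0);
  res1_projective : projective res1;
  res0_projective : projective res0;
  res_ses : ses res_in res_aug }.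

Lemma pdim_le1_resolution M : pdim_le1 M -> inhabited (resolution M).
Proof. by move=> [P1 [P0 [i [p [H1 H0 sip]]]]]; split; exists P1 P0 i p. Qed.

(* [Ext^1(M, N) = 0], computed by the resolution [r] as
   [coker (Hom(P0, N) -> Hom(P1, N))]. *)
Definition res_ext0 M (r : resolution M) N :=
  forall f : 'M_(mdim N, mdim (res1 r)), is_hom f ->
  exists2 g : 'M_(mdim N, mdim (res0 r)), is_hom g & g *m res_in r = f.

(** Lift [f] to [u] on [P0] by projectivity. On [P1] it lands in [U], and this restriction extends
    to [w] on [P0]; then [u - i *m w] kills [P1] and descends to [M]. *)
Lemma res_lift M (r : resolution M) U V W
    (i : 'M_(mdim V, mdim U)) (p : 'M_(mdim W, mdim V)) (f : 'M_(mdim W, mdim M)) :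
  ses i p -> res_ext0 r U -> is_hom f ->
  exists2 g : 'M_(mdim V, mdim M), is_hom g & p *m g = f.
Proof.
move=> sip ext0 hf; have [[hi hp injI surjP pi0] _] := sip.
have [[hj hq injJ surjQ qj0] _] := res_ses r.
have [u [hu pu]] := res0_projective hp surjP (hom_mul hf hq).
have [|v uE] := ses_factor sip (g := u *m res_in r).
  by rewrite mulmxA pu -mulmxA qj0 mulmx0.
have hv : is_hom v.
  by apply: (hom_injmx_cancel hi injI); rewrite -uE; apply: hom_mul.
have [w hw wE] := ext0 v hv.
have [|g gE] := ses_cofactor (res_ses r) (g := u - i *m w).
  by rewrite mulmxBl uE -wE mulmxA subrr.
have hg : is_hom g.
  apply: (hom_surjmx_cancel hq surjQ); rewrite -gE.
  by apply: hom_sub => //; apply: hom_mul.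
exists g => //; apply: (surjmx_cancel surjQ).
by rewrite -mulmxA -gE mulmxBr mulmxA pi0 mul0mx subr0 pu.
Qed.

(** From right to left, lifting the identity of [M] splits the sequence. From left to right, the
    pushout of the resolution along [f] is an extension of [M] by [N], and a retraction of it
    extends [f] to [P0]. *)
Lemma res_ext0P M (r : resolution M) N : ext1_vanishes M N <-> res_ext0 r N.
Proof.
split=> [ext0 f hf|ext0 E i p sip]; last first.
  have [s hs ps] := res_lift sip ext0 (hom1 M).
  have [[hi hp injI surjP pi0] _] := sip.
  have [|t tE] := ses_factor sip (g := 1%:M - s *m p).
    by rewrite mulmxBr mulmx1 mulmxA ps mul1mx subrr.
  exists t; split.
    apply: (hom_injmx_cancel hi injI); rewrite -tE.
    by apply: hom_sub; [apply: hom1 | apply: hom_mul].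
  apply: (injmx_cancel injI).
  by rewrite mulmxA -tE mulmxBl mul1mx -mulmxA pi0 mulmx0 subr0 mulmx1.
have [[hj hq injJ surjQ qj0] dM] := res_ses r; move: ext0 f hf hj hq injJ surjQ qj0 dM (res_ses r).
case: r => P1 P0 j q /= _ _ _ ext0 f hf hj hq injJ surjQ qj0 dM jq.
(* The cokernel of [d] is the pushout of [j] and [f]. *)
pose d := inl_mx P0 N *m j - inr_mx P0 N *m f.
have hd : is_hom d.
  by apply: hom_sub; apply: hom_mul => //; [apply: hom_inl | apply: hom_inr].
have prl : copair 1%:M 0 *m d = j.
  by rewrite mulmxBr !mulmxA copair_inl copair_inr mul1mx mul0mx subr0.
have injD : injmx d.
  have [j' j'j] := injmx_linv injJ.
  by apply: (@linv_injmx _ _ _ _ (j' *m copair 1%:M 0)); rewrite -mulmxA prl.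
have [E [e de]] := cokernel_ses hd injD.
have [[_ he _ surjE ed0] dE] := de.
have [|p pE] := ses_cofactor de (g := copair q (0 : 'M_(mdim M, mdim N))).
  by rewrite mulmxBr !mulmxA copair_inl copair_inr qj0 mul0mx subrr.
have hc : is_hom (copair q (0 : 'M_(mdim M, mdim N))).
  by apply: hom_copair => //; apply: hom0.
have edE : e *m inl_mx P0 N *m j = e *m inr_mx P0 N *m f.
  by apply/eqP; rewrite -subr_eq0 -!mulmxA -mulmxBr ed0.
have sE : ses (e *m inr_mx P0 N) p.
  split; last first.
    by apply: (@addnI (mdim P1)); rewrite -dE /= dM -addnA (addnC (mdim N)).
  split.
  - by apply: hom_mul => //; apply: hom_inr.
  - by apply: (hom_surjmx_cancel he surjE); rewrite -pE.
  (* A vector of [N] that dies in [E] is some [d *m y]; its component in [P0] is [j *m y = 0], so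
     [y = 0]. *)
  - apply: injmxI => r x; rewrite -mulmxA => /(ses_factor de)[y dy].
    have y0 : y = 0.
      apply: (injmx_cancel injJ); rewrite mulmx0 -prl -mulmxA -dy.
      by rewrite mulmxA copair_inr mul0mx.
    by rewrite -[x]mul1mx -(copair_inr (0 : 'M_(mdim N, mdim P0)) 1%:M) -mulmxA dy y0 !mulmx0.
  - apply/eqP; rewrite eqn_leq rank_leq_row -{1}surjQ /=.
    by rewrite -(copair_inl q (0 : 'M_(mdim M, mdim N))) pE -mulmxA mxrankM_maxl.
  - by rewrite mulmxA -pE copair_inr.
have [t [ht tE]] := ext0 _ _ _ sE.
exists (t *m (e *m inl_mx P0 N)); first by do 2!apply: hom_mul => //; apply: hom_inl.
by rewrite -mulmxA edE mulmxA tE mul1mx.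
Qed.
(** Right exactness of [Ext^1(M, -)]: a map from the projective [P1] lifts to [N], extends there to
    [P0], and is pushed down again. *)
Lemma res_ext0_quotient M (r : resolution M) N N' (p : 'M_(mdim N', mdim N)) :
  is_hom p -> surjmx p -> res_ext0 r N -> res_ext0 r N'.
Proof.
move=> hp surjP ext0 f hf.
have [u [hu <-]] := res1_projective hp surjP hf.
have [v hv <-] := ext0 u hu.
by exists (p *m v); [apply: hom_mul | rewrite mulmxA].
Qed.

Lemma res_ext0_dsum M (r : resolution M) N N' :
  res_ext0 r N -> res_ext0 r N' -> res_ext0 r (dsum N N').
Proof.
move=> ext0 ext0' f hf.
have hfst : is_hom (copair 1%:M (0 : 'M_(mdim N, mdim N'))).
  by apply: hom_copair; [apply: hom1 | apply: hom0].
have hsnd : is_hom (copair (0 : 'M_(mdim N', mdim N)) 1%:M).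
  by apply: hom_copair; [apply: hom0 | apply: hom1].
have [g hg gE] := ext0 _ (hom_mul hfst hf).
have [g' hg' gE'] := ext0' _ (hom_mul hsnd hf).
exists (inl_mx N N' *m g + inr_mx N N' *m g').
  by apply: hom_add; apply: hom_mul => //; [apply: hom_inl | apply: hom_inr].
rewrite mulmxDl -!mulmxA gE gE' !mulmxA -mulmxDl -[RHS]mul1mx; congr (_ *m _).
apply: dsum_hom_ext.
  by rewrite mulmxDl -!mulmxA !copair_inl mulmx0 addr0 mulmx1 mul1mx.
by rewrite mulmxDl -!mulmxA !copair_inr mulmx0 add0r mulmx1 mul1mx.
Qed.

(* With [e = i p] the idempotent of the retract lifted to [ε] on [P0], both
   [ε] and [1 - ε] map [L = ker (P0 -> M)] through a projective: [ε] into [P1]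
   and [1 - ε] into [L] from all of [P0]; hence [L] is a retract of
   [P1 + P0]. *)
Lemma resolution_retract X M (r : resolution X)
    (i : 'M_(mdim X, mdim M)) (p : 'M_(mdim M, mdim X)) :
  is_hom i -> is_hom p -> p *m i = 1%:M ->
  exists r' : resolution M, forall N, res_ext0 r N -> res_ext0 r' N.
Proof.
move=> hi hp pi1; case: r => P1 P0 j q proj1 proj0 jq.
have [[hj hq injJ surjQ qj0] _] := jq.
have surjP := rinv_surjmx pi1.
have [L [l lpq]] := kernel_ses (hom_mul hp hq) (surjmx_mul surjQ surjP).
have [[hl _ injL surjPQ pql0] _] := lpq.
have [e [he qe]] := proj0 _ _ _ _ hq surjQ (hom_mul (hom_mul hi hp) hq).
have [|a el] := ses_factor jq (g := e *m l).
  by rewrite mulmxA qe -!mulmxA (mulmxA p) pql0 mulmx0.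
have ha : is_hom a by apply: (hom_injmx_cancel hj injJ); rewrite -el; apply: hom_mul.
have [|b jb] := ses_factor lpq (g := j); first by rewrite -mulmxA qj0 mulmx0.
have hb : is_hom b by apply: (hom_injmx_cancel hl injL); rewrite -jb.
have [|c ce] := ses_factor lpq (g := 1%:M - e).
  by rewrite mulmxBr mulmx1 -mulmxA qe !mulmxA pi1 mul1mx subrr.
have hc : is_hom c.
  apply: (hom_injmx_cancel hl injL); rewrite -ce; apply: hom_sub => //; apply: hom1.
have bacl : b *m a + c *m l = 1%:M.
  apply: (injmx_cancel injL).
  by rewrite mulmxDr !mulmxA -jb -ce -el mulmxBl mul1mx addrC subrK mulmx1.
have projL : projective L.
  move=> V W g f hg surjG hf.
  have [u [hu gu]] := proj1 _ _ _ _ hg surjG (hom_mul hf hb).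
  have [v [hv gv]] := proj0 _ _ _ _ hg surjG (hom_mul hf hc).
  exists (u *m a + v *m l); split; first by apply: hom_add; apply: hom_mul.
  by rewrite mulmxDr !mulmxA gu gv -!mulmxA -mulmxDr bacl mulmx1.
exists (Resolution projL proj0 lpq) => N /= ext0 f hf.
(* [g] extends [f *m b] from [P1] to [P0]; by [bacl], [g *m e + f *m c] then restricts to [f] on
   [L]. *)
have [g hg gE] := ext0 _ (hom_mul hf hb); rewrite /= in g hg gE.
exists (g *m e + f *m c).
  by apply: hom_add; apply: hom_mul.
rewrite mulmxDl -!mulmxA el (mulmxA g) gE -!mulmxA -mulmxDr bacl mulmx1 //.
Qed.

Lemma res_ext0_retract M (r : resolution M) X N
    (i : 'M_(mdim X, mdim N)) (p : 'M_(mdim N, mdim X)) :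
  is_hom i -> is_hom p -> p *m i = 1%:M -> res_ext0 r X -> res_ext0 r N.
Proof. by move=> hi hp pi1; apply: res_ext0_quotient hp (rinv_surjmx pi1). Qed.

(** This is [chi(M, N)], written with the resolution so that additivity in [N] follows from
    projectivity alone. It is rational-valued for the sake of the linear relation among its
    values. *)
Definition euler M (r : resolution M) N : rat :=
  (\dim (homs (res0 r) N))%:R - (\dim (homs (res1 r) N))%:R.

Lemma euler_ses M (r : resolution M) U V W
    (i : 'M_(mdim V, mdim U)) (p : 'M_(mdim W, mdim V)) :
  ses i p -> euler r V = euler r U + euler r W.
Proof.
move=> sip; have proj1 : projective (res1 r) by apply: res1_projective.
have proj0 : projective (res0 r) by apply: res0_projective.
rewrite /euler (dim_homs_projective proj0 sip) (dim_homs_projective proj1 sip).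
by rewrite !natrD opprD addrACA.
Qed.

Lemma euler_zero M (r : resolution M) N : mdim N = 0%N -> euler r N = 0.
Proof.
move=> N0; suff dim0 P : \dim (homs P N) = 0%N by rewrite /euler !dim0 subrr.
apply: homs_dim0 => f _; apply/eqP; rewrite -mxrank_eq0 -leqn0 -N0.
exact: rank_leq_row.
Qed.

Lemma euler_iso M (r : resolution M) N N' : mod_iso N N' -> euler r N = euler r N'.
Proof.
move=> [f [g [hf _ gf fg]]].
have [Z [p sfp]] := cokernel_ses hf (linv_injmx gf).
have dN : mdim N = mdim N' := etrans (esym (linv_injmx gf)) (rinv_surjmx fg).
have Z0 : mdim Z = 0%N by apply: (@addnI (mdim N)); rewrite addn0 -sfp.2.
by rewrite (euler_ses r sfp) (euler_zero r Z0) addr0.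
Qed.

(** Vanishing of [Ext^1] makes [0 -> Hom(M, N) -> Hom(P0, N) -> Hom(P1, N) -> 0] exact at its right
    end too. *)
Lemma euler_ext0 M (r : resolution M) N :
  res_ext0 r N -> euler r N = (\dim (homs M N))%:R.
Proof.
case: r => P1 P0 j q proj1 proj0 jq; rewrite /euler /res_ext0 /= => ext0.
have [[hj hq injJ surjQ qj0] _] := jq.
suff -> : \dim (homs P0 N) = (\dim (homs M N) + \dim (homs P1 N))%N.
  by rewrite natrD addrK.
apply: (@dimv_exact _ _ _ _ (mulmxr q) (mulmxr j)) => /= [f|f _ fi0|f _|f|f|f].
- by move=> /mem_homs hf; apply/mem_homs/hom_mul.
- by apply: (surjmx_cancel surjQ); rewrite fi0 mul0mx.
- by rewrite -mulmxA qj0 mulmx0.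
- move=> /mem_homs hf /(ses_cofactor jq)[h fE]; exists h => //.
  by apply/mem_homs/(hom_surjmx_cancel hq surjQ); rewrite -fE.
- by move=> /mem_homs hf; apply/mem_homs/hom_mul.
- move=> /mem_homs hf; have [h hh <-] := ext0 _ hf.
  by exists h => //; apply/mem_homs.
Qed.

(* Induction on the dimension: a nonzero non-simple module is an extension of
   smaller ones. *)
Lemma euler_sum0 (F : finType) (M : F -> fdmodule A) (r : forall x, resolution (M x))
    (c : F -> rat) :
  (forall S, simple_mod S -> \sum_x c x * euler (r x) S = 0) ->
  forall N, \sum_x c x * euler (r x) N = 0.
Proof.
move=> simple0 N; have [m] := ubnP (mdim N); elim: m N => // m IH N ltNm.
have [N0|N0] := eqVneq (mdim N) 0%N.
  by rewrite big1 // => x _; rewrite euler_zero ?mulr0.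
have [/simple0//|notS] := pselect (simple_mod N).
have [U [f [hf injF U0 UN]]] : exists U (f : 'M_(mdim N, mdim U)),
    [/\ is_hom f, injmx f, mdim U != 0%N & mdim U != mdim N].
  apply: contrapT => noU; apply: notS; split; first by move/eqP; apply/negP.
  move=> U f hf injF; rewrite /is_zero_mod.
  apply: contrapT => /not_orP[/eqP U0 /eqP UN].
  by apply: noU; exists U, f.
have [W [p sfp]] := cokernel_ses hf injF.
have [_ dN] := sfp.
rewrite (eq_bigr _ (fun x _ => congr1 (GRing.mul (c x)) (euler_ses (r x) sfp))).
rewrite (eq_bigr _ (fun x _ => mulrDr _ _ _)) big_split /= !IH ?addr0 //.
  by rewrite ltnS in ltNm; apply: leq_trans ltNm; rewrite dN -[X in (X < _)%N]add0n ltn_add2r lt0n.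
rewrite ltnS in ltNm; apply: leq_trans ltNm; rewrite dN -[X in (X < _)%N]addn0 ltn_add2l lt0n.
by apply: contra_neq UN => W0; rewrite dN W0 addn0.
Qed.

End Resolutions.

(** * Local endomorphism rings of indecomposables and radical maps *)

Section Indecomposables.
Variables (K : fieldType) (A : falgType K).
Implicit Types (L M N P U V W X : fdmodule A).

Lemma hom_exp M (f : 'M_(mdim M)) k : @is_hom _ _ M M f -> @is_hom _ _ M M (f ^+ k).
Proof.
move=> hf; elim: k => [|k hk]; first by rewrite expr0; apply: hom1.
by rewrite exprS; apply: hom_mul.
Qed.

Lemma hom_invmx M (f : 'M_(mdim M)) :
  f \in unitmx -> @is_hom _ _ M M f -> @is_hom _ _ M M (invmx f).
Proof.
move=> fU hf; apply: (@hom_injmx_cancel _ _ M M M f) => //; first exact: mxrank_unit.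
by rewrite mulmxV //; apply: hom1.
Qed.

Lemma indecomposable_neq0 M : indecomposable M -> mdim M <> 0%N.
Proof. by case. Qed.

Lemma unitmx_neq0 n (f : 'M[K]_n) : n <> 0%N -> f \in unitmx -> f != 0.
Proof.
move=> n0 /mxrank_unit rf; apply/eqP => f0; apply: n0.
by rewrite -rf f0 mxrank0.
Qed.

(** [M] is the direct sum of the images of [e] and [1 - e]. *)
Lemma indecomposable_idempotent M (e : 'M_(mdim M)) :
  indecomposable M -> @is_hom _ _ M M e -> e *m e = e -> e = 0 \/ e = 1%:M.
Proof.
move=> [_ indM] he ee.
pose e' := 1%:M - e; have he' : @is_hom _ _ M M e' by apply: hom_sub => //; apply: hom1.
have ee0 : e *m e' = 0 by rewrite mulmxBr mulmx1 ee subrr.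
have ee0' : e' *m e = 0 by rewrite mulmxBl mul1mx ee subrr.
have e'e' : e' *m e' = e' by rewrite {1}/e' mulmxBl mul1mx ee0 subr0.
have [I [j [q [hj hq injJ surjQ eE]]]] := image_exists he.
have [I' [j' [q' [hj' hq' injJ' surjQ' eE']]]] := image_exists he'.
have qj : q *m j = 1%:M.
  apply: (injmx_cancel injJ); apply: (surjmx_cancel surjQ).
  by rewrite mulmx1 !mulmxA -eE -mulmxA -eE.
have qj' : q' *m j' = 1%:M.
  apply: (injmx_cancel injJ'); apply: (surjmx_cancel surjQ').
  by rewrite mulmx1 !mulmxA -eE' -mulmxA -eE'.
have qj'0 : q *m j' = 0.
  apply: (injmx_cancel injJ); apply: (surjmx_cancel surjQ').
  by rewrite mulmx0 mul0mx !mulmxA -eE -mulmxA -eE'.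
have q'j0 : q' *m j = 0.
  apply: (injmx_cancel injJ'); apply: (surjmx_cancel surjQ).
  by rewrite mulmx0 mul0mx !mulmxA -eE' -mulmxA -eE.
have factor0 n (u : 'M[K]_(mdim M, n)) (v : 'M_(n, mdim M)) : n = 0%N -> u *m v = 0.
  move=> n0; apply/eqP; rewrite -mxrank_eq0 -leqn0 -n0.
  by rewrite (leq_trans (mxrankM_maxl _ _)) // rank_leq_col.
have [|/factor0 e0|/factor0 e'0] := indM I I'; last 2 first.
- by left; rewrite eE.
- by right; apply/esym/eqP; rewrite -subr_eq0 -/e' eE' e'0.
(* The dependent matches give the injections and projections the types prescribed by [pair_fam]. *)
exists (fun i => if val i == 0%N as b return 'M_(mdim M, mdim (if b then I else I'))
                 then j else j').
exists (fun i => if val i == 0%N as b return 'M_(mdim (if b then I else I'), mdim M)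
                 then q else q').
split.
- by case=> [[|[|//]] ?].
- by case=> [[|[|//]] ?].
- by case=> [[|[|//]] ?].
- by case=> [[|[|//]] ?]; case=> [[|[|//]] ?].
- by rewrite big_ord_recl big_ord1 /= -eE -eE' addrC subrK.
Qed.

(** A positive power [g] of [f] of least rank has the same rank as [g *m g], so [M] is the direct
    sum of the image and the kernel of [g], one of which vanishes. *)
Lemma fitting_unit_or_nilpotent M (f : 'M_(mdim M)) :
  indecomposable M -> @is_hom _ _ M M f -> f \in unitmx \/ exists k, f ^+ k = 0.
Proof.
move=> indM hf.
pose P r := `[< exists k, r = \rank (f ^+ k.+1) >].
have exP : exists r, P r by exists (\rank (f ^+ 1)); apply/asboolP; exists 0%N.
case: (ex_minnP exP) => _ /asboolP[k ->] minr.
have hg := hom_exp k.+1 hf; set g := f ^+ k.+1 in hg minr.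
have rgg : (\rank g <= \rank (g *m g))%N.
  apply: minr; apply/asboolP; exists (k + k.+1)%N.
  by rewrite /g -addSn exprD.
have gU : g \in unitmx -> f \in unitmx by rewrite /g exprS -mulmxE unitmx_mul => /andP[].
have [I [j [q [hj hq injJ surjQ gE]]]] := image_exists hg.
have rg : \rank g = mdim I by rewrite gE mxrankMfree //; apply/surjmx_free.
have qjU : q *m j \in unitmx.
  rewrite -row_free_unit /row_free eqn_leq rank_leq_row -{1}rg (leq_trans rgg) //.
  by rewrite gE !mulmxA -(mulmxA j) (leq_trans (mxrankM_maxl _ _)) // mxrankM_maxr.
(* The projection onto the image of [g] along its kernel. *)
pose e := j *m invmx (q *m j) *m q.
have he : @is_hom _ _ M M e.
  by apply: hom_mul => //; apply: hom_mul => //; apply: hom_invmx => //; apply: hom_mul.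
have ej : e *m j = j by rewrite /e -!mulmxA mulVmx // mulmx1.
have [|e0|e1] := indecomposable_idempotent indM he.
- by rewrite {2}/e !mulmxA ej.
- by right; exists k.+1; rewrite -/g gE -ej e0 !mul0mx.
- left; apply: gU.
  suff /mulmx1_unit[] : g *m (j *m invmx (q *m j) *m invmx (q *m j) *m q) = 1%:M by [].
  by rewrite gE -!mulmxA (mulmxA q j) mulKVmx // mulmxA -/e e1.
Qed.

(** If [u = f + g] were a unit, the non-unit [f *m invmx u] would be nilpotent, and the geometric
    series would invert [1 - f *m invmx u = g *m invmx u]. *)
Lemma nonunit_add M (f g : 'M_(mdim M)) : indecomposable M ->
  @is_hom _ _ M M f -> @is_hom _ _ M M g ->
  f \notin unitmx -> g \notin unitmx -> f + g \notin unitmx.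
Proof.
move=> indM hf hg fN; apply: contra => uU.
set u := f + g in uU; have hu : @is_hom _ _ M M u by apply: hom_add.
have hf' : @is_hom _ _ M M (f *m invmx u) by apply: hom_mul => //; apply: hom_invmx.
have [|[k fk]] := fitting_unit_or_nilpotent indM hf'.
  by rewrite unitmx_mul (negPf fN).
have /mulmx1_unit[+ _] : (1%:M - f *m invmx u) *m (\sum_(i < k) (f *m invmx u) ^+ i) = 1%:M.
  by rewrite -opprB mulNmx mulmxE -subrX1 fk sub0r opprK.
rewrite -(mulmxV uU) -mulmxBl unitmx_mul => /andP[+ _].
by rewrite /u addrC addKr.
Qed.

(** Once [b] is normalized to a left inverse [b'] of [a], the product [a *m b'] is a nonzero
    idempotent of [L], hence the identity. *)
Lemma iso_of_unit_composite M L (a : 'M_(mdim L, mdim M)) (b : 'M_(mdim M, mdim L)) :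
  indecomposable M -> indecomposable L -> is_hom a -> is_hom b ->
  b *m a \in unitmx -> mod_iso M L.
Proof.
move=> indM indL ha hb baU; have hba : @is_hom _ _ M M (b *m a) by apply: hom_mul.
pose b' := invmx (b *m a) *m b.
have hb' : is_hom b' by apply: hom_mul => //; apply: hom_invmx.
have b'a : b' *m a = 1%:M by rewrite -mulmxA mulVmx.
have [|ab0|ab1] := indecomposable_idempotent indL (hom_mul ha hb').
- by rewrite -mulmxA (mulmxA b') b'a mul1mx.
- case/negP: (unitmx_neq0 (indecomposable_neq0 indM) baU).
  by rewrite -[a]mulmx1 -b'a (mulmxA a) ab0 mul0mx mulmx0.
- by exists a, b'.
Qed.

(** For indecomposable [M], this is the Jacobson radical of the module category. *)
Definition radical M N (f : 'M_(mdim N, mdim M)) : Prop :=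
  is_hom f /\ forall g : 'M_(mdim M, mdim N), is_hom g -> g *m f \notin unitmx.

Lemma radical_add M N (f g : 'M_(mdim N, mdim M)) :
  indecomposable M -> radical f -> radical g -> radical (f + g).
Proof.
move=> indM [hf rf] [hg rg]; split=> [|h hh]; first exact: hom_add.
by rewrite mulmxDr; apply: nonunit_add; rewrite ?rf ?rg //; apply: hom_mul.
Qed.

Lemma radical0 M N : indecomposable M -> @radical M N 0.
Proof.
move=> /indecomposable_neq0 M0; split=> [|h _]; first exact: hom0.
by rewrite mulmx0; apply/negP => /(unitmx_neq0 M0); rewrite eqxx.
Qed.

Lemma radical_through M L N (f : 'M_(mdim L, mdim M)) (g : 'M_(mdim N, mdim L)) :
  indecomposable M -> indecomposable L -> ~ mod_iso M L ->
  is_hom f -> is_hom g -> radical (g *m f).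
Proof.
move=> indM indL noiso hf hg; split=> [|h hh]; first exact: hom_mul.
apply/negP; rewrite mulmxA => hgf; apply: noiso.
by apply: (iso_of_unit_composite indM indL hf _ hgf); apply: hom_mul.
Qed.

Lemma radical_sub1_unit M (f : 'M_(mdim M)) :
  indecomposable M -> @radical M M f -> 1%:M - f \in unitmx.
Proof.
move=> indM [hf rf]; apply: contraT => fN.
have := nonunit_add indM hf _ _ fN; rewrite [f + _]addrC subrK unitmx1.
by apply; [apply: hom_sub => //; apply: hom1 | rewrite -[f]mul1mx; apply/rf/hom1].
Qed.

End Indecomposables.

(** * Generation within a family of modules, Nakayama's lemma and traces *)

Section Nakayama.
Variables (K : fieldType) (A : falgType K) (F : finType) (M : F -> fdmodule A).
Implicit Types (J : pred F).

(** Maps between members of the family act as scalars on the generators [s]; [homQ] allows all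
    homomorphisms as coefficients, [radQ] only radical ones. *)
Fixpoint lspan (Q : forall x y, 'M[K]_(mdim (M y), mdim (M x)) -> Prop)
    (s : seq {x & 'cV[K]_(mdim (M x))}) y (v : 'cV[K]_(mdim (M y))) : Prop :=
  if s is w :: s' then
    exists f v', [/\ Q (tag w) y f, lspan Q s' v' & v = f *m tagged w + v']
  else v = 0.

Definition homQ x y (f : 'M[K]_(mdim (M y), mdim (M x))) := is_hom f.
Definition radQ x y (f : 'M[K]_(mdim (M y), mdim (M x))) :=  radical f.

Lemma lspan_add (Q : forall x y, 'M[K]_(mdim (M y), mdim (M x)) -> Prop) J s y
    (v v' : 'cV_(mdim (M y))) :
  (forall x f g, J x -> Q x y f -> Q x y g -> Q x y (f + g)) ->
  all (J \o tag) s -> lspan Q s v -> lspan Q s v' -> lspan Q s (v + v').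
Proof.
move=> QD; elim: s v v' => [|w s IH] v v' /=; first by move=> _ -> ->; rewrite addr0.
move=> /andP[Jw Js] [f [u [Qf su ->]]] [f' [u' [Qf' su' ->]]].
exists (f + f'), (u + u'); split; [exact: QD | exact: IH |].
by rewrite mulmxDl addrACA.
Qed.

Lemma lspan0 (Q : forall x y, 'M[K]_(mdim (M y), mdim (M x)) -> Prop) J s y :
  (forall x, J x -> Q x y 0) -> all (J \o tag) s -> lspan Q s (0 : 'cV_(mdim (M y))).
Proof.
move=> Q0; elim: s => //= w s IH /andP[Jw Js]; exists 0, 0; split; [exact: Q0|exact: IH|].
by rewrite mul0mx addr0.
Qed.

Lemma lspan_map (Q Q' : forall x y, 'M[K]_(mdim (M y), mdim (M x)) -> Prop) J s y z
    (h : 'M_(mdim (M z), mdim (M y))) (v : 'cV_(mdim (M y))) :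
  (forall x f, J x -> Q x y f -> Q' x z (h *m f)) ->
  all (J \o tag) s -> lspan Q s v -> lspan Q' s (h *m v).
Proof.
move=> QQ'; elim: s v => [|w s IH] v /=; first by move=> _ ->; rewrite mulmx0.
move=> /andP[Jw Js] [f [u [Qf su ->]]]; exists (h *m f), (h *m u).
by split; [exact: QQ' | exact: IH | rewrite mulmxDr mulmxA].
Qed.

Lemma lspan_hom_add s y (v v' : 'cV_(mdim (M y))) :
  lspan homQ s v -> lspan homQ s v' -> lspan homQ s (v + v').
Proof.
apply: (@lspan_add _ predT); last exact/allP.
by move=> x f g _; apply: hom_add.
Qed.

Lemma lspan_hom0 s y : lspan homQ s (0 : 'cV_(mdim (M y))).
Proof. by apply: (@lspan0 _ predT); [move=> x _; apply: hom0 | apply/allP]. Qed.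

Lemma lspan_hom_catl s t y (v : 'cV_(mdim (M y))) : lspan homQ s v -> lspan homQ (s ++ t) v.
Proof.
elim: s v => [|w s IH] v /=; first by move=> ->; apply: lspan_hom0.
by move=> [f [u [hf su ->]]]; exists f, u; split=> //; apply: IH.
Qed.

Lemma lspan_hom_catr s t y (v : 'cV_(mdim (M y))) : lspan homQ t v -> lspan homQ (s ++ t) v.
Proof.
move=> tv; elim: s => //= w s IH; exists 0, v; split=> //; first exact: hom0.
by rewrite mul0mx add0r.
Qed.

Definition generating J s := forall x, J x -> forall v : 'cV_(mdim (M x)), lspan homQ s v.

Lemma generating_exists J : exists2 s, all (J \o tag) s & generating J s.
Proof.
suff [s Js sP] : exists2 s, all (J \o tag) s &
    forall x, x \in enum J -> forall v : 'cV_(mdim (M x)), lspan homQ s v.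
  by exists s => // x Jx v; apply: sP; rewrite mem_enum.
have: all J (enum J) by apply/allP => x; rewrite mem_enum.
elim: (enum J) => [|x r IH] /=; first by exists [::].
move=> /andP[Jx /IH[s Js sP]].
(* The standard basis of [M x]; scalar matrices are homomorphisms and serve as coefficients. *)
pose b := [seq Tagged (fun x => 'cV[K]_(mdim (M x))) (delta_mx k 0) | k <- enum 'I_(mdim (M x))].
exists (b ++ s) => [|y /predU1P[->|/sP sy] v]; last exact/lspan_hom_catr/sy.
  by rewrite all_cat Js andbT; apply/allP => _ /mapP[k _ ->].
apply: lspan_hom_catl; rewrite (matrix_sum_delta v) /b -[index_enum _]enumT.
elim: (enum _) => [|k ks IHk] /=; first by rewrite big_nil.
exists (v k 0)%:M, (\sum_(i <- ks) \sum_j v i j *: delta_mx i j).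
split=> //; first by move=> a; rewrite -scalar_mxC.
by rewrite big_cons big_ord1 mul_scalar_mx.
Qed.

(* If every member of the family indexed by [J] equals its radical, then a
   generator can always be dropped: [w = f w + ...] with [f] radical gives
   [w = (1 - f)^-1 (...)]. *)
Lemma nakayama J :
  (forall x, J x -> indecomposable (M x)) ->
  (forall s, all (J \o tag) s -> generating J s ->
     forall x, J x -> forall v : 'cV_(mdim (M x)), lspan radQ s v) ->
  forall x, ~~ J x.
Proof.
(* An empty list spans only zero vectors, whereas indecomposables are nonzero. *)
move=> indM radJ; suff [s] : exists2 s, s = [::] & generating J s.
  move=> -> gen x; apply/negP => Jx.
  have M0 : (0 < mdim (M x))%N.
    by rewrite lt0n; apply/eqP/indecomposable_neq0/indM.
  have /matrixP/(_ (Ordinal M0) 0)/eqP := gen x Jx (const_mx 1).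
  by rewrite !mxE oner_eq0.
have [s] := generating_exists J.
elim: s => [|w s IH]; first by exists [::].
move=> Jws; have /andP[Jw Js] := Jws; move=> gen; apply: IH => //.
have [f [u [rf su wE]]] := radJ _ Jws gen _ Jw (tagged w).
have fU := radical_sub1_unit (indM _ Jw) rf; have [hf _] := rf.
have hf1 : @is_hom _ _ (M (tag w)) (M (tag w)) (1%:M - f).
  by apply: hom_sub => //; apply: hom1.
have sw : lspan homQ s (tagged w).
  have -> : tagged w = invmx (1%:M - f) *m u.
    apply: (canRL (mulKmx fU)); rewrite mulmxBl mul1mx {1}wE addrC addKr //.
  apply: (lspan_map _ Js su) => x g Jx [hg _]; apply: hom_mul => //.
  exact: hom_invmx.
move=> x Jx v; have [g [v' [hg sv' ->]]] := gen x Jx v.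
apply: lspan_hom_add => //; apply: (lspan_map _ Js sw) => z h _ hh.
exact: hom_mul.
Qed.

Inductive sums J : fdmodule A -> Prop :=
| sums_zero : sums J (zero_module A)
| sums_add U x : sums J U -> J x -> sums J (dsum U (M x)).

Lemma sums_ext0 N (r : resolution N) J U :
  (forall x, J x -> res_ext0 r (M x)) -> sums J U -> res_ext0 r U.
Proof.
move=> extJ; elim=> [|{}U x _ extU Jx]; last by apply: res_ext0_dsum => //; apply: extJ.
move=> f _; exists 0; first exact: hom0.
by apply/matrixP => -[].
Qed.

(** Reduces a property of the image of [f] to images of maps from single members, as each vector of
    [U] is a sum of vectors of its summands. *)
Lemma sums_span J U N (f : 'M_(mdim N, mdim U)) (P : 'cV[K]_(mdim N) -> Prop) :
  sums J U -> is_hom f ->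
  P 0 -> (forall v w, P v -> P w -> P (v + w)) ->
  (forall x (h : 'M_(mdim N, mdim (M x))) v, J x -> is_hom h -> P (h *m v)) ->
  forall v, P (f *m v).
Proof.
move=> sU hf P0 PD PJ; elim: sU f hf => [|{}U x _ IH Jx] f hf v.
  by have -> : v = 0 by [apply/matrixP => -[]]; rewrite mulmx0.
have [y [z ->]] := dsum_col v; rewrite mulmxDr !mulmxA; apply: PD.
  by apply: IH; apply: hom_mul => //; apply: hom_inl.
by apply: PJ => //; apply: hom_mul => //; apply: hom_inr.
Qed.

(** The image of [f] is the trace of the family [J] in [N]. The factor [g] is a mere matrix:
    [h = f *m g] says that the image of [h] lies in that of [f]. Adjoining to [f] a map that does
    not factor raises the rank, so the process stops. *)
Lemma trace_exists J N : exists U (f : 'M_(mdim N, mdim U)),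
  [/\ sums J U, is_hom f &
      forall x (h : 'M_(mdim N, mdim (M x))), J x -> is_hom h -> exists g, h = f *m g].
Proof.
suff H m U (f : 'M_(mdim N, mdim U)) : sums J U -> is_hom f ->
    (mdim N - \rank f < m)%N -> exists U (f : 'M_(mdim N, mdim U)),
  [/\ sums J U, is_hom f &
      forall x (h : 'M_(mdim N, mdim (M x))), J x -> is_hom h -> exists g, h = f *m g].
  exact: (H _ _ _ (sums_zero J) (@hom0 _ _ (zero_module A) N) (ltnSn _)).
elim: m U f => // m IH U f sU hf lt_m.
have [full|] := pselect
  (forall x (h : 'M_(mdim N, mdim (M x))), J x -> is_hom h -> exists g, h = f *m g).
  by exists U, f.
move=> /existsNP[x /existsNP[h]] /not_implyP[Jx] /not_implyP[hh nofac].
apply: (IH _ (copair f h) (sums_add sU Jx) (hom_copair hf hh)).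
rewrite ltnS in lt_m; apply: leq_trans lt_m.
have fE : (f^T <= (copair f h)^T)%MS.
  by apply/submxP; exists (inl_mx U (M x))^T; rewrite -trmx_mul copair_inl.
have lt_rank : (\rank f < \rank (copair f h))%N.
  rewrite -(mxrank_tr f) -(mxrank_tr (copair f h)) ltn_neqAle mxrankS // andbT.
  rewrite (mxrank_leqif_sup fE); apply/negP => /submxP[g gE]; apply: nofac.
  exists (g^T *m inr_mx U (M x)); apply: trmx_inj.
  by rewrite mulmxA trmx_mul trmx_mul trmxK -gE -trmx_mul copair_inr.
by apply: ltn_sub2l => //; apply: leq_trans lt_rank _; apply: rank_leq_row.
Qed.

End Nakayama.

(** * Families without extensions and the bound by the number of simples *)

Section RigidFamilies.
Variables (K : fieldType) (A : falgType K) (F : finType) (M : F -> fdmodule A).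
Hypothesis indM : forall x, indecomposable (M x).
Hypothesis noisoM : forall x y, x != y -> ~ mod_iso (M x) (M y).

Definition generated_by (J : pred F) N := exists U (f : 'M_(mdim N, mdim U)),
  [/\ sums M J U, is_hom f & surjmx f].

(* Otherwise every element of a module in [J] would be a sum of images under
   composites through modules in [J'], which are radical maps. *)
Lemma no_mutual_generation (J J' : pred F) :
  (forall x, J x -> ~~ J' x) ->
  (forall x, J x -> generated_by J' (M x)) ->
  (forall x, J' x -> generated_by J (M x)) ->
  forall x, ~~ J x.
Proof.
move=> disj genJ genJ'; apply: (nakayama (fun x _ => indM x)) => s Js gens x Jx v.
have span0 : lspan (@radQ _ _ _ M) s (0 : 'cV_(mdim (M x))).
  by apply: (@lspan0 _ _ _ _ _ J) => // y _; apply: radical0.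
have spanD (u w : 'cV_(mdim (M x))) :
    lspan (@radQ _ _ _ M) s u -> lspan (@radQ _ _ _ M) s w ->
    lspan (@radQ _ _ _ M) s (u + w).
  by apply: (@lspan_add _ _ _ _ _ J) => // y f g _; apply: radical_add.
have [U [f [sU hf /surjmx_rinv[f' ff']]]] := genJ x Jx.
rewrite -[v]mul1mx -ff' -mulmxA.
apply: (sums_span sU hf (P := lspan (@radQ _ _ _ M) s (y := x))) => // y h w J'y hh.
have [V [g [sV hg /surjmx_rinv[g' gg']]]] := genJ' y J'y.
rewrite -[w]mul1mx -gg' -mulmxA.
apply: (sums_span sV hg (P := fun w => lspan (@radQ _ _ _ M) s (h *m w))).
- by rewrite mulmx0.
- by move=> u u' su su'; rewrite mulmxDr; apply: spanD.
move=> z h' u Jz hh'; rewrite mulmxA.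
apply: (lspan_map _ Js (gens z Jz u)) => t e Jt he.
rewrite -mulmxA; apply: (radical_through (L := M y)) => //; last exact: hom_mul.
by apply: noisoM; apply: contraL J'y => /eqP<-; apply: disj.
Qed.

Variable r : forall x, resolution (M x).
Hypothesis rigidM : forall x y, res_ext0 (r x) (M y).

(* The trace [I] of the modules in [J] and the quotient [C = M x / I] are both
   Ext-orthogonal to the family, and every map from [M y] to [C] with [y] in
   [J] lifts to [M x], hence lands in [I]. *)
Lemma generated_by_vanishing (J : pred F) x :
  (forall N, (forall y, res_ext0 (r y) N) -> (forall y, J y -> \dim (homs (M y) N) = 0%N) ->
     \dim (homs (M x) N) = 0%N) ->
  generated_by J (M x).
Proof.
move=> vanish; have [U [f [sU hf fac]]] := trace_exists M J (M x).
have [I [j [q [hj hq injJ surjQ fE]]]] := image_exists hf.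
have [C [p jp]] := cokernel_ses hj injJ.
have [[_ hp _ surjP pj0] _] := jp.
have extI y : res_ext0 (r y) I.
  by apply: (res_ext0_quotient hq surjQ); apply: sums_ext0 sU => z _; apply: rigidM.
have extC y : res_ext0 (r y) C by apply: (res_ext0_quotient hp surjP); apply: rigidM.
have p0 : p = 0.
  apply: homs_eq0 hp; apply: vanish => // y Jy; apply: homs_dim0 => g hg.
  have [h hh <-] := res_lift jp (extI y) hg.
  have [k ->] := fac y h Jy hh.
  by rewrite fE !mulmxA pj0 !mul0mx.
have [|k jk] := ses_factor jp (g := 1%:M); first by rewrite p0 mul0mx.
exists U, f; split=> //; rewrite fE; apply: surjmx_mul surjQ _.
by apply: (@rinv_surjmx _ _ _ _ k).
Qed.

Lemma card_rigid_resolution k : num_simple_classes A k -> (#|F| <= k)%N.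
Proof.
move=> [S [simpS noisoS allS]]; rewrite leqNgt; apply/negP => ltk.
(* With more modules than simples this matrix has more rows than columns, so its rows satisfy a
   nontrivial relation [c]. *)
pose E : 'M[rat]_(#|F|, k) := \matrix_(i, s) euler (r (enum_val i)) (S s).
have /rowV0Pn[c /sub_kermxP cE c0] : kermx E != 0.
  rewrite kermx_eq0; apply/negP => /eqP rE; move: ltk.
  by rewrite ltnNge -{1}rE rank_leq_col.
pose d x : rat := c 0 (enum_rank x).
have sum0 N : \sum_x d x * euler (r x) N = 0.
  apply: euler_sum0 => T simpT; have [s iso] := allS T simpT.
  transitivity ((c *m E) 0 s); last by rewrite cE mxE.
  rewrite mxE [RHS](reindex enum_rank) /=; last exact: onW_bij (@enum_rank_bij F).
  by apply: eq_bigr => x _; rewrite mxE enum_rankK (euler_iso _ iso).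
(* For [N] without extensions by the family and without maps from the members of negative
   coefficient, the relation is a vanishing sum of nonnegative terms; so [Hom(M x, N) = 0] whenever
   [e x] is positive. *)
have vanish (e : F -> rat) : (forall N, \sum_x e x * euler (r x) N = 0) ->
    forall x, 0 < e x -> generated_by (fun y => e y < 0) (M x).
  move=> e0 x ex; apply: generated_by_vanishing => N extN homN.
  have : \sum_y e y * (\dim (homs (M y) N))%:R = 0 :> rat.
    rewrite -[RHS](e0 N); apply: eq_bigr => y _.
    by rewrite (euler_ext0 (extN y)).
  move=> /psumr_eq0P H; have := H _ x isT.
  move=> /(_ _)/eqP; rewrite mulf_eq0 gt_eqF //= pnatr_eq0 => H'.
  apply/eqP; apply: H' => y _; have [ey|ey] := ltP (e y) 0.
    by rewrite homN // mulr0.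
  by rewrite mulr_ge0 // ler0n.
have sum0' N : \sum_x (- d x) * euler (r x) N = 0.
  apply: (oppr_inj); rewrite oppr0 -[RHS](sum0 N) -sumrN.
  by apply: eq_bigr => x _; rewrite mulNr opprK.
have gen1 := vanish d sum0.
have gen2 x : d x < 0 -> generated_by (fun y => 0 < d y) (M x).
  rewrite -oppr_gt0 => /(vanish _ sum0'); congr (generated_by _ _).
  by apply/funext => y; rewrite oppr_lt0.
(* Members of positive and of negative coefficient generate each other, so neither kind exists and
   [c] is zero. *)
have npos := no_mutual_generation (fun x (dx : 0 < d x) => negbT (lt_gtF dx)) gen1 gen2.
have nneg := no_mutual_generation (fun x (dx : d x < 0) => negbT (lt_gtF dx)) gen2 gen1.
case/negP: c0; apply/eqP/rowP => i; rewrite mxE.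
have := npos (enum_val i); have := nneg (enum_val i).
by rewrite /d enum_valK; case: ltgtP.
Qed.

End RigidFamilies.

(** * Summands of tilting modules *)

Section Bounds.
Variables (K : fieldType) (A : falgType K).

Lemma card_partial_tilting (F : finType) (M : F -> fdmodule A) k :
  (forall x, indecomposable (M x)) ->
  (forall x y, x != y -> ~ mod_iso (M x) (M y)) ->
  (forall x, inhabited (resolution (M x))) ->
  (forall x y, ext1_vanishes (M x) (M y)) ->
  num_simple_classes A k -> (#|F| <= k)%N.
Proof.
move=> indM noisoM resM rigidM simples.
have r x : resolution (M x).
  have /cid[//] : exists r : resolution (M x), True by have [r] := resM x; exists r.
apply: (card_rigid_resolution indM noisoM (r := r)) => // x y.
exact/res_ext0P.
Qed.

(** The Krull-Schmidt argument: the identity of [Z] is the sum of its composites through the [X i],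
    and non-units are closed under addition, so one composite is a unit. *)
Lemma indecomposable_summand (T Z : fdmodule A) n (X : 'I_n -> fdmodule A) :
  is_direct_sum T X -> (forall i, indecomposable (X i)) ->
  indecomposable Z -> direct_summand Z T -> exists i, mod_iso Z (X i).
Proof.
move=> [inj [proj [hinj hproj _ _ sum1]]] indX indZ [Z' [inj' [proj' [hinj' hproj' pi1 _ _]]]].
have := pi1 ord0; have := hinj' ord0; have := hproj' ord0.
move: (inj' ord0) (proj' ord0) => /= a b hb ha ba1.
have /existsP[i bU] : [exists i, b *m (inj i *m proj i) *m a \in unitmx].
  apply: contraT => /existsPn nonunit.
  have hi i : @is_hom _ _ Z Z (b *m (inj i *m proj i) *m a).
    by apply: hom_mul ha; apply: hom_mul hb _; apply: hom_mul.
  suff : b *m (\sum_i inj i *m proj i) *m a \notin unitmx.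
    by rewrite sum1 mulmx1 ba1 unitmx1.
  rewrite mulmx_sumr mulmx_suml.
  elim: (index_enum _) => [|i s IH].
    rewrite big_nil; apply/negP => /(unitmx_neq0 (indecomposable_neq0 indZ)).
    by rewrite eqxx.
  rewrite big_cons; apply: nonunit_add => //; exact: hom_sum.
exists i; apply: (iso_of_unit_composite (a := proj i *m a) (b := b *m inj i)) => //.
- exact: hom_mul.
- exact: hom_mul.
- by rewrite !mulmxA in bU *.
Qed.

(** The [k] classes of indecomposable summands inject into the indices of [X], and condition (γ)
    makes [k] the number of simples. *)
Lemma card_tilting_summands (T : fdmodule A) n (X : 'I_n -> fdmodule A) :
  tilting T -> is_direct_sum T X -> (forall i, indecomposable (X i)) ->
  exists2 k, num_simple_classes A k & (k <= n)%N.
Proof.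
move=> [_ _ [k [[Z [indZ noisoZ _]] simples]]] sumX indX; exists k => //.
have isoX i : exists j, mod_iso (Z i) (X j).
  by have [indZi sumZ] := indZ i; apply: indecomposable_summand sumX indX indZi sumZ.
have [f fP] := choice isoX.
suff injf : injective f by rewrite -(card_ord k) -(card_ord n); apply: leq_card injf.
move=> i j fij; apply: contrapT => /eqP /noisoZ; apply.
have [a [b [ha hb ba ab]]] := fP i; have := fP j; rewrite -fij => -[c [d [hc hd dc cd]]].
exists (d *m a), (b *m c); split; try exact: hom_mul.
  by rewrite -mulmxA (mulmxA c) cd mul1mx.
by rewrite -mulmxA (mulmxA a) ab mul1mx.
Qed.

Lemma summand_resolution (T : fdmodule A) n (X : 'I_n -> fdmodule A) :
  pdim_le1 T -> is_direct_sum T X -> forall i, inhabited (resolution (X i)).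
Proof.
move=> /pdim_le1_resolution[r] [inj [proj [hinj hproj pi1 _ _]]] i.
by have [r' _] := resolution_retract r (hinj i) (hproj i) (pi1 i); split.
Qed.

(** The first argument passes to a retract through [resolution_retract], the second because a
    retract is a quotient. *)
Lemma summand_ext1 (T : fdmodule A) n (X : 'I_n -> fdmodule A) :
  pdim_le1 T -> ext1_vanishes T T -> is_direct_sum T X ->
  forall i j, ext1_vanishes (X i) (X j).
Proof.
move=> /pdim_le1_resolution[r] extT [inj [proj [hinj hproj pi1 _ _]]] i j.
have [r' rr'] := resolution_retract r (hinj i) (hproj i) (pi1 i).
apply/(res_ext0P r')/(res_ext0_retract (hinj j) (hproj j) (pi1 j)).
exact/rr'/res_ext0P.
Qed.

Lemma nonsplit_ses_ext1 (U W : fdmodule A) :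
  ~ nonsplit_ses_exists U W -> ext1_vanishes W U.
Proof.
move=> nosES E i p sip; apply: contrapT => nosplit.
by apply: nosES; exists E, i, p.
Qed.

Lemma mod_iso_sym (U W : fdmodule A) : mod_iso U W -> mod_iso W U.
Proof. by move=> [f [g [hf hg gf fg]]]; exists g, f. Qed.

End Bounds.

Theorem theorem4 (K : fieldType) (A : falgType K) (n : nat)
  (X Y : fdmodule A) (Xs Ys : 'I_n -> fdmodule A) :
  tilting X -> tilting Y ->
  is_direct_sum X Xs -> is_direct_sum Y Ys ->
  (forall i, indecomposable (Xs i)) -> (forall i, indecomposable (Ys i)) ->
  (forall i j, i != j -> ~ mod_iso (Xs i) (Xs j)) ->
  (forall i j, i != j -> ~ mod_iso (Ys i) (Ys j)) ->
  exists s : 'S_n, forall i : 'I_n,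
    mod_iso (Xs i) (Ys (s i)) \/
    nonsplit_ses_exists (Xs i) (Ys (s i)) \/
    nonsplit_ses_exists (Ys (s i)) (Xs i).
Proof.
move=> tX tY sumX sumY indX indY noisoX noisoY.
pose related i j := mod_iso (Xs i) (Ys j) \/
  nonsplit_ses_exists (Xs i) (Ys j) \/ nonsplit_ses_exists (Ys j) (Xs i).
pose N i := [set j | `[< related i j >]].
suff hallN (I : {set 'I_n}) : (#|I| <= #|neighbours N I|)%N.
  have [f [injf fN]] := hall_marriage hallN.
  exists (perm injf) => i; rewrite permE.
  by have := fN i; rewrite inE => /asboolP.
have unrelated i j : i \in I -> j \notin neighbours N I -> ~ related i j.
  move=> iI; apply: contraNnot => rij; apply/bigcupP; exists i => //.
  by rewrite inE; apply/asboolP.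
(* The index set of the family made of the [Xs i] with [i] in [I] and the [Ys j] with [j] outside
   the neighbours of [I]. *)
pose ok (x : 'I_n + 'I_n) := match x with inl i => i \in I | inr j => j \notin neighbours N I end.
pose F : finType := {x | ok x}.
pose M (x : F) := match val x with inl i => Xs i | inr j => Ys j end.
have [k simples le_kn] := card_tilting_summands tX sumX indX.
have [pdX extX _] := tX; have [pdY extY _] := tY.
have card_F : #|F| = (#|I| + #|~: neighbours N I|)%N.
  rewrite card_sig -[LHS]sum1_card big_sumType /= !sum1_card; congr (_ + _)%N.
  by apply: eq_card => j; rewrite !inE.
(* The family has [#|I| + (n - #|neighbours N I|)] members, so this bound is Hall's condition for
   [I]. *)
suff : (#|F| <= n)%N.
  have := cardsC (neighbours N I); rewrite card_ord => cardN.
  by rewrite card_F -[leqRHS]cardN leq_add2r.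
apply: leq_trans le_kn; apply: (card_partial_tilting (M := M)) simples.
- by case=> -[i|j] okx; rewrite /M /=.
- case=> -[i|i] oki [] [j|j] okj; rewrite -val_eqE /M /= => neq.
  + exact: noisoX.
  + by move=> iso; apply: (unrelated i j oki okj); left.
  + by move=> /mod_iso_sym iso; apply: (unrelated j i okj oki); left.
  + exact: noisoY.
- case=> -[i|j] okx; rewrite /M /=.
  + exact: summand_resolution pdX sumX i.
  + exact: summand_resolution pdY sumY j.
(* In the mixed cases a nonzero [Ext^1] in either direction would relate [Xs] and [Ys]; the first
   argument of [ext1_vanishes] is the quotient term, so the order is swapped against
   [nonsplit_ses_exists]. *)
- case=> -[i|i] oki [] [j|j] okj; rewrite /M /=.
  + exact: summand_ext1 pdX extX sumX i j.
  + by apply: nonsplit_ses_ext1 => ses; apply: (unrelated i j oki okj); right; right.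
  + by apply: nonsplit_ses_ext1 => ses; apply: (unrelated j i okj oki); right; left.
  + exact: summand_ext1 pdY extY sumY i j.
Qed.
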